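(* Let $D\subseteq\mathcal B^n$ be a compact subset, $f\colon D\to\mathbb R$ a continuous function, and $\varepsilon>0$. Then there exists a (finite real) linear combination of absolute polynomials $g\colon\mathcal B^n\to\mathbb R$ such that $\|f-g\|_\infty\le\varepsilon$, where $\|\cdot\|_\infty$ denotes the supremum norm on $D$.
   Context: $K$ is a field with a non-trivial valuation $\mathrm{val}\colon K\to\mathbb R\cup\{\infty\}$, complete with respect to the associated non-Archimedean absolute value $|a|=\exp(-\mathrm{val}(a))$ (base fixed). $\hat K$ is the completion of an algebraic closure of $K$, with the unique extension of $|\cdot|$. For $a\in K^n$, $r\in\mathbb R_{\ge0}^n$ put $B_{\mathcal B}(a,r)=\{z\in\hat K^n: |a_i-z_i|\le r_i\ \forall i\}$, and let $\mathcal B^n$ be the set of all of these polydiscs. The topology on $\mathcal B^n$ is the one induced by the metric $d_{\mathcal B}^p$ (independent of $p\in[1,\infty]$). Here, on $\mathcal B^1$, $d_{\mathcal B}(B_{\mathcal B}(a,r),B_{\mathcal B}(a',r'))=|r-r'|$ if one disc contains the other, and $d_{\mathcal B}(B,B')=d_{\mathcal B}(B,B\vee B')+d_{\mathcal B}(B\vee B',B')$ with $B\vee B'=B_{\mathcal B}(a,|a-a'|)$ otherwise. On $\mathcal B^n$, $d_{\mathcal B}^p(B,B')=(\sum_i d_{\mathcal B}(B_i,B_i')^p)^{1/p}$ (maximum if $p=\infty$), where $B=\prod_i B_i$ and $B'=\prod_i B_i'$. A polynomial over $\mathcal B$ is a formal sum $h=\sum_{\alpha\in\mathbb Z_{\ge0}^n}C_\alpha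 x^\alpha$ with $C_\alpha\in\mathcal B^1$ and $C_\alpha=B_{\mathcal B}(0,0)$ for all but finitely many $\alpha$. The associated absolute polynomial is the function $|h|\colon\mathcal B^n\to\mathbb R_{\ge0}$, $B\mapsto|h(B)|=\sup_{c_\alpha\in C_\alpha,\,z\in B}\big|\sum_\alpha c_\alpha z^\alpha\big|$. In particular, for $h\in K[x_1,\dots,x_n]$, $|h(B)|=\sup_{z\in B}|h(z)|$. *)

(* Defs.v *)
From HB Require Import structures.
From mathcomp Require Import all_boot all_order all_algebra.
From mathcomp Require Import all_classical all_reals all_analysis.
Set Implicit Arguments.
Unset Strict Implicit.
Unset Printing Implicit Defensive.
Import Order.TTheory GRing.Theory Num.Theory.
Import numFieldNormedType.Exports.
Local Open Scope classical_set_scope.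
Local Open Scope ring_scope.

HB.mixin Record Field_isValued (R : realType) K of GRing.Field K := {
  valuation : K -> \bar R;
  valuation_neqNy : forall x, valuation x <> -oo%E;
  valuation_eqy : forall x, valuation x = +oo%E <-> x = 0;
  valuationM : forall x y, valuation (x * y) = (valuation x + valuation y)%E;
  valuationD : forall x y,
    (Order.min (valuation x) (valuation y) <= valuation (x + y)%R)%E
}.

#[short(type="valuedFieldType")]
HB.structure Definition ValuedField (R : realType) :=
  {K of GRing.Field K & Field_isValued R K}.

Definition nontrivial_valuation (R : realType) (K : valuedFieldType R) : Prop :=
  exists x : K, x != 0 /\ valuation x != 0%E.

(* |x| = exp (- val x); expeR sends -oo to 0. *)
Definition vabs (R : realType) (K : valuedFieldType R) (x : K) : R :=
  fine (expeR (- valuation x)).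

Lemma vabs_ge0 (R : realType) (K : valuedFieldType R) (x : K) : 0 <= vabs x.
Proof. exact/fine_ge0/expeR_ge0. Qed.

Definition complete_valued (R : realType) (K : valuedFieldType R) : Prop :=
  forall u : nat -> K,
    (forall e : R, 0 < e -> exists N : nat, forall m k : nat,
        (N <= m)%N -> (N <= k)%N -> vabs (u m - u k) < e) ->
    exists l : K, (fun m => vabs (u m - l)) @ \oo --> (0 : R).

(* A completion cl_hat of an algebraic closure cl_alg of K, with valuations
   extending that of K.  These data are unique up to isometric isomorphism
   when K is complete. *)
Record completed_closure (R : realType) (K : valuedFieldType R) :=
  CompletedClosure {
  cl_alg : valuedFieldType R;
  cl_hat : valuedFieldType R;
  to_alg : {rmorphism K -> cl_alg};
  to_hat : {rmorphism cl_alg -> cl_hat};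
  cl_alg_closed : GRing.closed_field_axiom cl_alg;
  cl_alg_algebraic : forall x : cl_alg, algebraicOver to_alg x;
  to_alg_valuation : forall x : K, valuation (to_alg x) = valuation x;
  to_hat_valuation : forall x : cl_alg, valuation (to_hat x) = valuation x;
  to_hat_dense : forall (z : cl_hat) (e : R), 0 < e ->
    exists x : cl_alg, vabs (to_hat x - z) < e;
  cl_hat_complete : complete_valued cl_hat
}.

Section Polydiscs.
Variables (R : realType) (K : valuedFieldType R) (Kc : completed_closure K).
Local Notation hatK := (cl_hat Kc).

Definition incl (x : K) : hatK := to_hat Kc (to_alg Kc x).

Definition disc_of (a : K) (r : R) : set hatK :=
  [set z | vabs (incl a - z) <= r].

Record disc := Disc {
  disc_set :> set hatK;
  disc_setP : exists ar : K * R, 0 <= ar.2 /\ disc_set = disc_of ar.1 ar.2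
}.

Definition mk_disc (a : K) (r : R) (r_ge0 : 0 <= r) : disc :=
  @Disc (disc_of a r) (ex_intro _ (a, r) (conj r_ge0 erefl)).

(* The center is a chosen one, but the radius is determined by the set when
   the valuation is nontrivial, the value group of hatK being then dense. *)
Definition disc_center (B : disc) : K := (projT1 (cid (disc_setP B))).1.
Definition disc_radius (B : disc) : R := (projT1 (cid (disc_setP B))).2.

Definition disc_join (B B' : disc) : disc :=
  mk_disc (disc_center B) (vabs_ge0 (disc_center B - disc_center B')).

Definition nested_dist (B B' : disc) : R := `|disc_radius B - disc_radius B'|.

Definition disc_dist (B B' : disc) : R :=
  if `[< B `<=` B' \/ B' `<=` B >] then nested_dist B B'
  else nested_dist B (disc_join B B') + nested_dist (disc_join B B') B'.

Definition polydisc_of (n : nat) (a : 'I_n -> K) (r : 'I_n -> R) :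
    set ('I_n -> hatK) :=
  [set z | forall i, vabs (incl (a i) - z i) <= r i].

Record polydisc (n : nat) := Polydisc {
  polydisc_set :> set ('I_n -> hatK);
  polydisc_setP : exists ar : ('I_n -> K) * ('I_n -> R),
    (forall i, 0 <= ar.2 i) /\ polydisc_set = polydisc_of ar.1 ar.2
}.

(* The i-th factor B_i of B = \prod_i B_i. *)
Definition polydisc_comp (n : nat) (B : polydisc n) (i : 'I_n) : disc :=
  let c := cid (polydisc_setP B) in
  mk_disc ((projT1 c).1 i) ((projT2 c).1 i).

(* Meaningful for 1 <= p; the fallback branch is the case p = +oo. *)
Definition polydisc_dist (p : \bar R) (n : nat) (B B' : polydisc n) : R :=
  if p is q%:E then
    (\sum_(i < n) disc_dist (polydisc_comp B i) (polydisc_comp B' i) `^ q)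
      `^ q^-1
  else \big[Num.max/0]_(i < n)
         disc_dist (polydisc_comp B i) (polydisc_comp B' i).

Definition polydisc_space (p : \bar R) (n : nat) := polydisc n.

Definition polydisc_open (p : \bar R) (n : nat) (U : set (polydisc n)) : Prop :=
  forall B, U B -> exists2 e : R, 0 < e &
    forall B', polydisc_dist p B B' < e -> U B'.

Lemma polydisc_openT (p : \bar R) (n : nat) : @polydisc_open p n setT.
Proof. by move=> B _; exists 1. Qed.

Lemma polydisc_openI (p : \bar R) (n : nat) : setI_closed (@polydisc_open p n).
Proof.
move=> U V Uo Vo B [/Uo[e e0 He] /Vo[d d0 Hd]].
exists (Num.min e d); first by rewrite lt_min e0.
by move=> B'; rewrite lt_min => /andP[/He UB' /Hd VB'].
Qed.

Lemma polydisc_open_bigU (p : \bar R) (n : nat) (I : Type)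
  (F : I -> set (polydisc n)) :
  (forall i, polydisc_open p (F i)) -> polydisc_open p (\bigcup_i F i).
Proof.
move=> Fo B [i _ /Fo[e e0 He]]; exists e => // B' /He FB'.
by exists i.
Qed.

HB.instance Definition _ (p : \bar R) (n : nat) :=
  gen_eqMixin (polydisc_space p n).
HB.instance Definition _ (p : \bar R) (n : nat) :=
  gen_choiceMixin (polydisc_space p n).
HB.instance Definition _ (p : \bar R) (n : nat) :=
  isOpenTopological.Build (polydisc_space p n)
    (@polydisc_openT p n) (@polydisc_openI p n) (@polydisc_open_bigU p n).

Record disc_poly (n : nat) := DiscPoly {
  disc_coef : {ffun 'I_n -> nat} -> disc;
  disc_coef_finite :
    finite_set [set alpha | disc_coef alpha <> disc_of 0 0 :> set hatK]
}.

(* The sum over all exponents has finite support, since c_alpha = 0 whenever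
   C_alpha = B(0, 0); the set of values is nonempty and bounded. *)
Definition abs_poly (n : nat) (h : disc_poly n) (B : polydisc n) : R :=
  sup [set y | exists (c : {ffun 'I_n -> nat} -> hatK) (z : 'I_n -> hatK),
    [/\ forall alpha, disc_set (disc_coef h alpha) (c alpha), polydisc_set B z &
        y = vabs (\sum_(alpha \in [set: {ffun 'I_n -> nat}])
                    c alpha * \prod_(i < n) z i ^+ alpha i)]].

Definition lin_comb_abs_poly (n : nat) (g : polydisc n -> R) : Prop :=
  exists (m : nat) (lambda : 'I_m -> R) (h : 'I_m -> disc_poly n),
    forall B, g B = \sum_(j < m) lambda j * abs_poly (h j) B.

End Polydiscs.

Definition sup_norm (R : realType) (T : Type) (D : set T) (u : T -> R) : \bar R :=
  ereal_sup [set `|u x|%:E | x in D].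

(* Main.v *)
(* By Stone-Weierstrass it suffices to find, among the linear combinations of
   absolute polynomials, a point-separating algebra of continuous functions.
   The linear forms x_i - b with b in K do: |x_i - b| takes the value
   max(|a_i - b|, r_i) on the polydisc B(a, r), is 1-Lipschitz, and the
   functions obtained for all i and b determine B. Products of such functions
   are again absolute polynomials, since the value group of the completed
   algebraic closure is dense: at a point z with all |z_i - a_i| slightly below
   r_i, the linear forms of a given finite family almost reach their suprema
   simultaneously. *)
Require Import Defs.
From HB Require Import structures.
From mathcomp Require Import all_boot all_order all_algebra ring lra.
From mathcomp Require Import all_classical all_reals all_analysis.
Set Implicit Arguments.
Unset Strict Implicit.
Unset Printing Implicit Defensive.
Import Order.TTheory GRing.Theory Num.Theory.
Import numFieldNormedType.Exports.
Local Open Scope classical_set_scope.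
Local Open Scope ring_scope.

(** * Stone-Weierstrass *)

(** Compactness as an induction principle. If [P D] failed, the sets V for which [P] holds on D
    minus V would form a proper filter containing D. At a cluster point, a neighbourhood V such that
    [P] holds on D meet V puts its own complement into that filter, yet V must meet every member. *)
Lemma compact_local (T : topologicalType) (D : set T) (P : set T -> Prop) :
  compact D -> P set0 ->
  (forall U V, U `<=` V -> P V -> P U) ->
  (forall U V, P U -> P V -> P (U `|` V)) ->
  (forall x, D x -> exists2 V, nbhs x V & P (D `&` V)) -> P D.
Proof.
move=> D_compact P0 Psub PU Ploc; apply: contrapT => NPD.
pose F : set_system T := [set V | P (D `\` V)].
have F_proper : ProperFilter F.
  split; first by rewrite /F /= setD0.
  split => [|U V|U V UV] /=; rewrite /F /=.
  - by rewrite setDT.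
  - by rewrite setDIr; exact: PU.
  - by apply: Psub => z [Dz NVz]; split=> // /UV.
have FD : F D by rewrite /F /= setDv.
have [x [Dx x_cluster]] := D_compact F F_proper FD.
have [V xV PV] := Ploc x Dx.
have FCV : F (~` V) by rewrite /F /= setDE setCK.
by have [z []] := x_cluster _ _ FCV xV.
Qed.

Section AbsApproximation.
Variable R : realType.

(** The iteration q + (t^2 - q^2) / 2 for the square root of t^2. Every iterate is a polynomial in
    t, so it can be applied inside an algebra of functions. *)
Fixpoint abs_approx (n : nat) (t : R) : R :=
  if n is m.+1 then
    abs_approx m t + 2^-1 * (t * t - abs_approx m t * abs_approx m t)
  else 0.

(** With u for |t| and q for the N-th iterate, the invariant is u - q <= u / (1 + N u / 2), cleared
    of denominators. It persists because u - q' = (u - q) (1 - (u + q) / 2) and (1 - (u + q) / 2) (1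
    + (N + 1) u / 2) <= 1 + N u / 2. *)
Lemma abs_approx_step (u q N q' : R) :
  0 <= u <= 1 -> 0 <= q <= u -> 0 <= N -> (u - q) * (1 + N * u / 2) <= u ->
  q' = q + 2^-1 * (u * u - q * q) ->
  0 <= q' <= u /\ (u - q') * (1 + (N + 1) * u / 2) <= u.
Proof.
move=> /andP[u0 u1] /andP[q0 qu] N0 IH ->.
have uq : 0 <= u - q by rewrite subr_ge0.
have H1 : 0 <= (u - q) * (2 - (u + q)) by rewrite mulr_ge0 //; lra.
have H2 : 0 <= (u - q) * (u + q) by rewrite mulr_ge0 //; lra.
split; first by apply/andP; split; lra.
apply: le_trans IH.
have -> : u - (q + 2^-1 * (u * u - q * q)) = (u - q) * (1 - (u + q) / 2) by field.
rewrite -mulrA ler_wpM2l //.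
have Nu : 0 <= N * u by rewrite mulr_ge0.
have Nuq : 0 <= N * u * q by rewrite mulr_ge0.
have Nuu : 0 <= N * u * u by rewrite mulr_ge0.
have uu : 0 <= u * u by rewrite mulr_ge0.
have uq' : 0 <= u * q by rewrite mulr_ge0.
lra.
Qed.

Lemma abs_approx_bound (n : nat) (t : R) : `|t| <= 1 ->
  0 <= abs_approx n t <= `|t| /\
  (`|t| - abs_approx n t) * (1 + n%:R * `|t| / 2) <= `|t|.
Proof.
move=> t1; have t0 := normr_ge0 t.
elim: n => [|n [q_bnd IH]] /=.
  by rewrite lexx t0 subr0 !mul0r addr0 mulr1.
have <- : `|t| * `|t| = t * t by rewrite -normrM -expr2 ger0_norm // sqr_ge0.
by rewrite -[n.+1%:R]natr1; apply: (abs_approx_step _ q_bnd _ IH); rewrite // t0.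
Qed.

Lemma abs_approx_dist (n : nat) (t : R) : `|t| <= 1 ->
  `| `|t| - abs_approx n.+1 t| <= 2 / n.+1%:R.
Proof.
move=> /(abs_approx_bound n.+1)[/andP[q0 qt] H].
set q := abs_approx n.+1 t in q0 qt H *; rewrite ger0_norm ?subr_ge0 //.
have n0 : 0 < n.+1%:R :> R by [].
move: (n.+1%:R) n0 H => N n0 H; set u := `|t| in qt H *.
rewrite ler_pdivlMr //.
(* The invariant yields (u - q) N u <= 2 u, from which u is cancelled; if u = 0 then q = 0 as
   well. *)
have [u0|u0] := eqVneq u 0; first by nra.
have {}u0 : 0 < u by rewrite lt_def u0 /u normr_ge0.
have : (u - q) * N * u <= 2 * u by nra.
by rewrite ler_pM2r.
Qed.

End AbsApproximation.

Section StoneWeierstrass.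
Variables (R : realType) (T : topologicalType) (D : set T).
Hypothesis D_compact : compact D.
Variable A : set (T -> R).
Hypothesis A_cst : forall c, A (fun=> c).
Hypothesis A_add : forall f g, A f -> A g -> A (fun x => f x + g x).
Hypothesis A_mul : forall f g, A f -> A g -> A (fun x => f x * g x).
Hypothesis A_cont : forall f, A f -> {within D, continuous f}.
Hypothesis A_sep : forall x y, D x -> D y -> x <> y -> exists2 f, A f & f x <> f y.

Let approximable (f : T -> R) := forall e : R, 0 < e ->
  exists2 g, A g & forall x, D x -> `|f x - g x| <= e.

(** The uniform closure of [A] on [D], which turns out to be a vector lattice. Continuity is carried
    along so that strict inequalities spread from a point to a neighbourhood. *)
Let L : set (T -> R) := [set f | {within D, continuous f} /\ approximable f].

Lemma within_continuous_bounded (f : T -> R) : {within D, continuous f} ->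
  exists2 M, 0 < M & forall x, D x -> `|f x| <= M.
Proof.
move=> /subspace_continuousP f_cont.
apply: (compact_local (P := fun V =>
  exists2 M, 0 < M & forall x, V x -> `|f x| <= M)) => //.
- by exists 1.
- by move=> U V UV [M M0 VM]; exists M => // x /UV /VM.
- move=> U V [M M0 UM] [N N0 VN]; exists (M + N); first exact: addr_gt0.
  move=> x [/UM|/VN] fx; apply: (le_trans fx); rewrite ?lerDl ?lerDr; exact: ltW.
- move=> x Dx; exists [set z | D z -> `|f z| <= `|f x| + 1].
    have /cvgr_dist_le/(_ _ ltr01) := f_cont x Dx.
    rewrite near_withinE; apply: filterS => z /= H /H {}H.
    rewrite -lerBlDl; apply: le_trans (lerB_dist _ _) _.
    by rewrite distrC.
  exists (`|f x| + 1); first by rewrite ltr_wpDl.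
  by move=> z [Dz]; apply.
Qed.

Lemma algebra_sub_closure f : A f -> L f.
Proof.
move=> Af; split; first exact: A_cont.
by move=> e e0; exists f => // x _; rewrite subrr normr0 ltW.
Qed.

Lemma closure_add f g : L f -> L g -> L (fun x => f x + g x).
Proof.
move=> [fc fa] [gc ga]; split.
  apply/subspace_continuousP => x Dx.
  by apply: cvgD; [move/subspace_continuousP: fc|move/subspace_continuousP: gc]; apply.
move=> e e0; have e2 : 0 < e / 2 by rewrite divr_gt0.
have [f' Af' f'P] := fa _ e2; have [g' Ag' g'P] := ga _ e2.
exists (fun x => f' x + g' x); first exact: A_add.
move=> x Dx; rewrite opprD addrACA [e]splitr.
by apply: le_trans (ler_normD _ _) _; rewrite lerD ?f'P ?g'P.
Qed.

Lemma closure_scale c f : L f -> L (fun x => c * f x).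
Proof.
move=> [fc fa]; split.
  apply/subspace_continuousP => x Dx.
  by apply: cvgMr; move/subspace_continuousP: fc; apply.
move=> e e0; have c0 : 0 < `|c| + 1 by rewrite ltr_wpDl.
have [g Ag gP] := fa _ (divr_gt0 e0 c0).
exists (fun x => c * g x); first exact: A_mul.
move=> x Dx; rewrite -mulrBr normrM.
apply: (@le_trans _ _ ((`|c| + 1) * (e / (`|c| + 1)))).
  by apply: ler_pM => //; [rewrite lerDl|exact: gP].
by rewrite mulrCA divff ?mulr1 ?gt_eqF.
Qed.

Lemma algebra_abs_approx n f : A f -> A (fun x => abs_approx n (f x)).
Proof.
move=> Af; elim: n => [|n IH] /=; first exact: A_cst.
apply: (A_add IH); apply: (A_mul (A_cst _)); apply: A_add; first exact: A_mul.
under eq_fun do rewrite -mulN1r.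
by apply: (A_mul (A_cst _)); exact: A_mul.
Qed.

Lemma closure_abs f : L f -> L (fun x => `|f x|).
Proof.
move=> [fc fa]; split.
  apply/subspace_continuousP => x Dx.
  by apply: cvg_norm; move/subspace_continuousP: fc; apply.
move=> e e0; have e2 : 0 < e / 2 by rewrite divr_gt0.
have [g Ag gP] := fa _ e2.
have [M M0 gM] := within_continuous_bounded (A_cont Ag).
(* Dividing by M brings g into [-1, 1]. Since n + 1 > 4 M / e, the rescaled error 2 M / (n + 1)
   stays below e / 2. *)
pose n := Num.truncn (4 * M / e).
exists (fun x => M * abs_approx n.+1 (M^-1 * g x)).
  by apply: (A_mul (A_cst _)); apply: algebra_abs_approx; apply: A_mul.
move=> x Dx; rewrite [e]splitr.
apply: le_trans (ler_distD `|g x| _ _) (lerD _ _).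
  by apply: le_trans (gP x Dx); exact: ler_dist_dist.
have Mg : `|M^-1 * g x| <= 1.
  by rewrite normrM gtr0_norm ?invr_gt0 // mulrC ler_pdivrMr // mul1r gM.
have -> : `|g x| = M * `|M^-1 * g x|.
  by rewrite normrM gtr0_norm ?invr_gt0 // mulrA divff ?mul1r ?gt_eqF.
rewrite -mulrBr normrM gtr0_norm //.
apply: (@le_trans _ _ (M * (2 / n.+1%:R))).
  by rewrite ler_pM2l // abs_approx_dist.
have : 4 * M / e < n.+1%:R by rewrite truncnS_gt.
have n0 : 0 < n.+1%:R :> R by [].
move: (n.+1%:R) n0 => N n0; rewrite ltr_pdivrMr // => H.
rewrite mulrA ler_pdivrMr //; lra.
Qed.

Lemma closure_max f g : L f -> L g -> L (fun x => Num.max (f x) (g x)).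
Proof.
move=> Lf Lg.
have -> : (fun x => Num.max (f x) (g x)) =
    (fun x => 2^-1 * ((f x + g x) + `|f x + (-1) * g x|)).
  by apply/funext => x; rewrite mulN1r maxr_absE mulrC.
apply: closure_scale; apply: closure_add; first exact: closure_add.
by apply: closure_abs; apply: closure_add => //; exact: closure_scale.
Qed.

Lemma closure_min f g : L f -> L g -> L (fun x => Num.min (f x) (g x)).
Proof.
move=> Lf Lg.
have -> : (fun x => Num.min (f x) (g x)) =
    (fun x => (-1) * Num.max ((-1) * f x) ((-1) * g x)).
  by apply/funext => x; rewrite !mulN1r -oppr_min opprK.
by apply: closure_scale; apply: closure_max; exact: closure_scale.
Qed.

Lemma closure_interpolation (f : T -> R) x y : D x -> D y ->
  exists g, [/\ L g, g x = f x & g y = f y].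
Proof.
move=> Dx Dy; have [<-|xy] := pselect (x = y).
  by exists (fun=> f x); split => //; apply: algebra_sub_closure.
have [h Ah /eqP hxy] := A_sep Dx Dy xy.
have hyx : h y - h x != 0 by rewrite subr_eq0 eq_sym.
exists (fun z => f x + (f y - f x) / (h y - h x) * (h z + - h x)); split.
- apply: algebra_sub_closure; apply: (A_add (A_cst _)); apply: (A_mul (A_cst _)).
  exact: A_add.
- by rewrite subrr mulr0 addr0.
- by rewrite divfK // addrC subrK.
Qed.

(** Two compactness arguments in the lattice [L]: for fixed x, a finite minimum of interpolants
    agreeing with f at x lies below f + d; a finite maximum of such minima also lies above f - d.
    Half of e is spent here, the other half on passing from [L] to [A]. *)
Theorem stone_weierstrass (f : T -> R) (e : R) :
  {within D, continuous f} -> 0 < e ->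
  exists2 g, A g & forall x, D x -> `|f x - g x| <= e.
Proof.
move=> f_cont e0; have e2 : 0 < e / 2 by rewrite divr_gt0.
set d := e / 2 in e2.
have near_lt g x : L g -> D x -> `|f x - g x| < d ->
    nbhs x [set z | D z -> `|f z - g z| < d].
  move=> [gc _] Dx H.
  have fg : f z - g z @[z --> within D (nbhs x)] --> f x - g x.
    by apply: cvgB; [move/subspace_continuousP: f_cont|
      move/subspace_continuousP: gc]; apply.
  have : \forall z \near within D (nbhs x), `|f z - g z| < d.
    exact: cvgr_lt (cvg_norm fg) _ H.
  by rewrite near_withinE.
have below x : D x ->
    exists g, [/\ L g, g x = f x & forall z, D z -> g z < f z + d].
  move=> Dx; apply: (compact_local (P := fun V =>
    exists g, [/\ L g, g x = f x & forall z, V z -> g z < f z + d])) => //.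
  - by exists (fun=> f x); split => //; apply: algebra_sub_closure.
  - by move=> U V UV [g [Lg gx gV]]; exists g; split => // z /UV /gV.
  - move=> U V [g [Lg gx gU]] [h [Lh hx hV]].
    exists (fun z => Num.min (g z) (h z)); split.
    + exact: closure_min.
    + by rewrite gx hx minxx.
    + by move=> z [/gU|/hV] H; rewrite gt_min H ?orbT.
  - move=> y Dy; have [g [Lg gx gy]] := closure_interpolation f Dx Dy.
    have H : `|f y - g y| < d by rewrite gy subrr normr0.
    exists [set z | D z -> `|f z - g z| < d]; first exact: near_lt.
    exists g; split => // z [Dz /= /(_ Dz)].
    by rewrite ltr_norml => /andP[]; lra.
have [g [Lg gD]] : exists g,
    L g /\ forall z, D z -> g z < f z + d /\ f z - d < g z.
  (* Empty [D] is treated apart: the induction below starts at the empty set with the function that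
     [below] provides at a point of [D]. *)
  have [[x0 Dx0]|D0] := pselect (exists x, D x); last first.
    exists (fun=> 0); split; first exact: algebra_sub_closure.
    by move=> z Dz; case: D0; exists z.
  suff [g [Lg gD gD']] : exists g, [/\ L g, forall z, D z -> g z < f z + d &
      forall z, D z -> f z - d < g z].
    by exists g; split => // z Dz; split; [exact: gD|exact: gD'].
  apply: (compact_local (P := fun V => exists g,
    [/\ L g, forall z, D z -> g z < f z + d &
      forall z, V z -> f z - d < g z])) => //.
  - by have [g [Lg _ gD]] := below _ Dx0; exists g; split.
  - by move=> U V UV [g [Lg gD gV]]; exists g; split => // z /UV /gV.
  - move=> U V [g [Lg gD gU]] [h [Lh hD hV]].
    exists (fun z => Num.max (g z) (h z)); split.
    + exact: closure_max.
    + by move=> z Dz; rewrite gt_max gD ?hD.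
    + by move=> z [/gU|/hV] H; rewrite lt_max H ?orbT.
  - move=> x Dx; have [g [Lg gx gD]] := below x Dx.
    have H : `|f x - g x| < d by rewrite gx subrr normr0.
    exists [set z | D z -> `|f z - g z| < d]; first exact: near_lt.
    exists g; split => // z [Dz /= /(_ Dz)].
    by rewrite ltr_norml => /andP[]; lra.
have [h Ah hP] := Lg.2 _ e2; exists h => // x Dx.
rewrite [e]splitr -/d; apply: le_trans (ler_distD (g x) _ _) (lerD _ _).
  by rewrite ler_norml; have := gD x Dx; lra.
exact: hP.
Qed.

End StoneWeierstrass.

(** * Non-Archimedean absolute values *)

Lemma bernoulli_ineq (R : realDomainType) (x : R) (n : nat) :
  -1 <= x -> 1 + n%:R * x <= (1 + x) ^+ n.
Proof.
move=> x1; elim: n => [|n IH]; first by rewrite mul0r addr0.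
rewrite exprS -natr1; apply: (@le_trans _ _ ((1 + x) * (1 + n%:R * x))).
  have : 0 <= n%:R * (x * x) by rewrite mulr_ge0 // -expr2 sqr_ge0.
  lra.
by rewrite ler_wpM2l // -lerBlDl sub0r.
Qed.

Lemma exists_expr_gt (R : realType) (q x : R) : 1 < q -> exists n, x < q ^+ n.
Proof.
move=> q1; exists (Num.truncn (x / (q - 1))).+1.
have q0 : 0 < q - 1 by rewrite subr_gt0.
have q1' : -1 <= q - 1 by lra.
have := bernoulli_ineq (Num.truncn (x / (q - 1))).+1 q1'.
rewrite [1 + (q - 1)]addrC subrK; apply: lt_le_trans.
have : x / (q - 1) < (Num.truncn (x / (q - 1))).+1%:R by rewrite truncnS_gt.
rewrite ltr_pdivrMr //; lra.
Qed.

Section AbsoluteValue.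
Variables (R : realType) (K : valuedFieldType R).
Implicit Types x y : K.

Lemma vabs0 : vabs (0 : K) = 0.
Proof. by rewrite /vabs (valuation_eqy (0 : K)).2. Qed.

Lemma valuation_fin x : x != 0 ->
  exists2 v : R, valuation x = v%:E & vabs x = expR (- v).
Proof.
move=> /eqP x0; rewrite /vabs; case E : (valuation x) => [v||].
- by exists v.
- by case: x0; apply/valuation_eqy.
- by case: (valuation_neqNy x).
Qed.

Lemma vabs_gt0 x : x != 0 -> 0 < vabs x.
Proof. by move=> /valuation_fin[v _ ->]; exact: expR_gt0. Qed.

Lemma vabs_le0 x : (vabs x <= 0) = (x == 0).
Proof.
have [->|x0] := eqVneq x 0; first by rewrite vabs0 lexx.
by rewrite leNgt vabs_gt0.
Qed.

Lemma vabsM x y : vabs (x * y) = vabs x * vabs y.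
Proof.
have [->|x0] := eqVneq x 0; first by rewrite mul0r vabs0 mul0r.
have [->|y0] := eqVneq y 0; first by rewrite mulr0 vabs0 mulr0.
have [u xu ->] := valuation_fin x0; have [v yv ->] := valuation_fin y0.
by rewrite /vabs valuationM xu yv -expRD -opprD.
Qed.

Lemma vabs1 : vabs (1 : K) = 1.
Proof.
have /gt_eqF/negbT v0 : 0 < vabs (1 : K) by exact/vabs_gt0/oner_neq0.
by apply: (mulfI v0); rewrite -vabsM !mulr1.
Qed.

Lemma vabsX x n : vabs (x ^+ n) = vabs x ^+ n.
Proof. by elim: n => [|n IH]; rewrite ?vabs1 // !exprS vabsM IH. Qed.

Lemma vabsV x : vabs x^-1 = (vabs x)^-1.
Proof.
have [->|x0] := eqVneq x 0; first by rewrite invr0 vabs0 invr0.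
have /gt_eqF/negbT v0 := vabs_gt0 x0.
by apply: (mulfI v0); rewrite -vabsM !divff // vabs1.
Qed.

Lemma vabsN x : vabs (- x) = vabs x.
Proof.
have /eqP : vabs (-1 : K) ^+ 2 = 1 by rewrite -vabsX sqrrN expr1n vabs1.
rewrite sqrf_eq1 => /orP[|] /eqP N1; first by rewrite -mulN1r vabsM N1 mul1r.
by have := vabs_ge0 (-1 : K); rewrite N1; lra.
Qed.

Lemma vabsB x y : vabs (x - y) = vabs (y - x).
Proof. by rewrite -vabsN opprB. Qed.

Lemma vabs_prod (I : Type) (r : seq I) (F : I -> K) :
  vabs (\prod_(i <- r) F i) = \prod_(i <- r) vabs (F i).
Proof. exact: (big_morph _ vabsM vabs1). Qed.

Lemma vabsD_le x y : vabs (x + y) <= Num.max (vabs x) (vabs y).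
Proof.
have [->|x0] := eqVneq x 0; first by rewrite add0r le_max lexx orbT.
have [->|y0] := eqVneq y 0; first by rewrite addr0 le_max lexx.
have [->|xy0] := eqVneq (x + y) 0; first by rewrite vabs0 le_max vabs_ge0.
have := valuationD x y.
have [u -> ->] := valuation_fin x0; have [v -> ->] := valuation_fin y0.
have [w -> ->] := valuation_fin xy0.
by rewrite le_max !ler_expR !lerN2 ge_min !lee_fin.
Qed.

Lemma vabsD_le_both x y r : vabs x <= r -> vabs y <= r -> vabs (x + y) <= r.
Proof. by move=> xr yr; apply: le_trans (vabsD_le _ _) _; rewrite ge_max xr. Qed.

(** If |x + y| < |y|, then y = (x + y) - x would have absolute value at most max(|x + y|, |x|) <
    |y|. *)
Lemma vabsD_lt x y : vabs x < vabs y -> vabs (x + y) = vabs y.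
Proof.
move=> xy; apply/le_anti/andP; split; first by rewrite vabsD_le_both // ltW.
rewrite leNgt; apply/negP => H.
have := vabsD_le (x + y) (- x); rewrite addrC addKr vabsN.
by apply/negP; rewrite -ltNge gt_max H xy.
Qed.

(** Every point of an ultrametric disc is a center of it; this makes [rho] below independent of the
    chosen center. *)
Lemma max_vabs_center x y z r : vabs (x - y) <= r ->
  Num.max (vabs (x - z)) r = Num.max (vabs (y - z)) r.
Proof.
have half u v : vabs (u - v) <= r ->
    Num.max (vabs (u - z)) r <= Num.max (vabs (v - z)) r.
  move=> uv; rewrite ge_max [X in _ && X]le_max lexx orbT andbT.
  rewrite -(subrKA v); apply: vabsD_le_both; first by rewrite le_max uv orbT.
  by rewrite le_max lexx.
by move=> xy; apply/eqP; rewrite eq_le !half // vabsB.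
Qed.

End AbsoluteValue.

(** * Density of the value group, and the functions |x - b| on discs *)

Section Density.
Variables (R : realType) (K : valuedFieldType R).
Hypothesis K_nontrivial : nontrivial_valuation K.
Variable Kc : completed_closure K.
Local Notation hatK := (cl_hat Kc).
Local Notation incl := (Defs.incl Kc).
Local Notation disc_of := (@Defs.disc_of R K Kc).

Lemma inclB x y : incl (x - y) = incl x - incl y.
Proof. by rewrite /Defs.incl !rmorphB. Qed.

Lemma vabs_incl x : vabs (incl x) = vabs x.
Proof. by rewrite /vabs to_hat_valuation to_alg_valuation. Qed.

Lemma exists_vabs_gt1 : exists x : K, 1 < vabs x.
Proof.
have [x [x0 vx]] := K_nontrivial.
have [v xv Ex] := valuation_fin x0.
have v0 : v != 0 by move: vx; rewrite xv.
have [v_lt0|v_gt0|v_eq0] := ltgtP v 0; last by rewrite v_eq0 eqxx in v0.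
  by exists x; rewrite Ex expR_gt1 oppr_gt0.
by exists x^-1; rewrite vabsV Ex expRN invrK expR_gt1.
Qed.

Lemma exists_root (x : K) n : (0 < n)%N -> exists w : hatK, w ^+ n = incl x.
Proof.
case: n => // n _.
(* [cl_alg_closed] makes a power of w equal to a combination of lower powers with coefficients [P];
   only the constant one is kept. *)
pose P i : cl_alg Kc := if i == 0%N then to_alg Kc x else 0.
have [w wP] := @cl_alg_closed _ _ Kc n.+1 P isT.
exists (to_hat Kc w); rewrite -rmorphXn wP big_ord_recl big1 /P /=.
  by rewrite expr0 mulr1 addr0.
by move=> i _; rewrite mul0r.
Qed.

(** A root w of high order of some c with |c| > 1 satisfies 1 < |w| < t / s, so the powers of |w|
    cannot jump over an interval whose endpoints have ratio t / s. *)
Lemma vabs_dense (s t : R) : 0 <= s -> s < t ->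
  exists z : hatK, s < vabs z < t.
Proof.
move=> s0 st; wlog {s0} s0 : s st / 0 < s.
  move=> H; have [||z /andP[sz zt]] := H (Num.max s (t / 2)).
  - by rewrite gt_max st /=; lra.
  - by rewrite lt_max orbC; apply/orP; left; lra.
  - by exists z; rewrite zt andbT; move: sz; rewrite gt_max => /andP[].
have [c c1] := exists_vabs_gt1.
have c0 : 0 < vabs c by rewrite (lt_trans _ c1).
have [N cN] : exists N, vabs c < (t / s) ^+ N.
  by apply: exists_expr_gt; rewrite ltr_pdivlMr // mul1r.
have N0 : (0 < N)%N by case: N cN => // /lt_trans/(_ c1); rewrite ltxx.
have [w wN] := exists_root c N0.
have vwN : vabs w ^+ N = vabs c by rewrite -vabsX wN vabs_incl.
have w1 : 1 < vabs w by rewrite -(expr_gt1 N0) ?vabs_ge0 ?vwN.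
have wts : vabs w < t / s.
  rewrite -(ltr_pXn2r N0) ?nnegrE ?vabs_ge0 ?vwN //.
  by rewrite divr_ge0 ?ltW // (lt_trans s0).
(* The interval is scaled by |c|^M to lie above 1. The least power of |w| beyond its left end then
   has a positive exponent, and the preceding power shows that it is below the right end. *)
have [M sM] := exists_expr_gt s^-1 c1.
have cM : 0 < vabs c ^+ M by rewrite exprn_gt0.
have sM1 : 1 < s * vabs c ^+ M by rewrite -ltr_pdivrMl // mulr1.
have [j] := ex_minnP (exists_expr_gt (s * vabs c ^+ M) w1).
case: j => [|j]; first by rewrite expr0 ltNge ltW.
move=> Hj /(_ j); rewrite ltnn => jmin.
have {jmin} wj : vabs w ^+ j <= s * vabs c ^+ M.
  by rewrite leNgt; apply/negP => /jmin.
exists (w ^+ j.+1 / incl c ^+ M).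
rewrite vabsM vabsV !vabsX vabs_incl ltr_pdivlMr // Hj /= ltr_pdivrMr //.
rewrite exprS; apply: (@le_lt_trans _ _ (vabs w * (s * vabs c ^+ M))).
  by rewrite ler_wpM2l ?vabs_ge0.
by rewrite mulrA ltr_pM2r // -ltr_pdivlMr.
Qed.

Lemma disc_of_center (a : K) (r : R) : 0 <= r -> disc_of a r (incl a).
Proof. by move=> r0; rewrite /disc_of /= subrr vabs0. Qed.

(** If r' < r, a point at distance strictly between r' and r from a lies in the first disc, but by
    the isosceles property not in the second. Hence a disc, as a set, determines its radius. *)
Lemma disc_of_subset (a a' : K) (r r' : R) : 0 <= r -> 0 <= r' ->
  disc_of a r `<=` disc_of a' r' -> r <= r' /\ vabs (a' - a) <= r'.
Proof.
move=> r0 r'0 sub.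
have aa' : vabs (a' - a) <= r'.
  by rewrite -vabs_incl inclB; apply: sub; exact: disc_of_center.
split=> //; rewrite leNgt; apply/negP => r'r.
have [w /andP[r'w wr]] := vabs_dense r'0 r'r.
have /sub : disc_of a r (incl a + w).
  by rewrite /disc_of /= opprD addNKr vabsN ltW.
rewrite /disc_of /= opprD addrA -inclB vabsD_lt ?vabsN.
  by rewrite leNgt r'w.
by rewrite vabs_incl (le_lt_trans aa').
Qed.

(* For [t] close to 1, [z] is a point of the disc at which all the linear
   polynomials [x - b] with [b] in [L] almost reach their suprema at once:
   it is enough that [|z - a|] lies strictly between [r] and the largest
   [|a - b|] below [r]. *)
Lemma disc_generic_point (a : K) (r t : R) (L : seq K) :
  0 <= r -> 0 <= t -> t < 1 ->
  exists2 z : hatK, disc_of a r z & forall b, b \in L ->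
    t * Num.max (vabs (a - b)) r <= vabs (z - incl b).
Proof.
move=> r0 t0 t1; have [r_eq0|r_neq0] := eqVneq r 0.
  exists (incl a); first exact: disc_of_center.
  move=> b _; rewrite -inclB vabs_incl r_eq0 max_l ?vabs_ge0 //.
  by rewrite ler_piMl ?vabs_ge0 // ltW.
have {r_neq0} r_gt0 : 0 < r by rewrite lt_def r_neq0.
(* The bound t r <= m serves the b with |a - b| < r, where |z - b| = |z - a| must reach t r. If |a -
   b| >= r, then |z - b| = |a - b| exactly. *)
have [m [tm mr mL]] : exists m, [/\ t * r <= m, m < r &
    forall b, b \in L -> vabs (a - b) < r -> vabs (a - b) <= m].
  elim: L => [|c L [m [tm mr mL]]].
    by exists (t * r); split => //; rewrite gtr_pMl.
  have [cr|rc] := ltP (vabs (a - c)) r; last first.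
    exists m; split => // b; rewrite inE => /orP[/eqP ->|/mL//].
    by rewrite ltNge rc.
  exists (Num.max (vabs (a - c)) m); split.
  - by rewrite le_max tm orbT.
  - by rewrite gt_max cr mr.
  - move=> b; rewrite inE le_max => /orP[/eqP -> _|/mL H /H ->].
      by rewrite lexx.
    by rewrite orbT.
have m0 : 0 <= m by apply: le_trans tm; rewrite mulr_ge0 // ltW.
have [w /andP[mw wr]] := vabs_dense m0 mr.
exists (incl a + w) => [|b bL].
  by rewrite /disc_of /= opprD addNKr vabsN ltW.
rewrite addrAC -inclB; have [br|rb] := ltP (vabs (a - b)) r.
  rewrite vabsD_lt ?vabs_incl; last by rewrite (le_lt_trans (mL _ bL br)).
  by apply: le_trans tm _; exact: ltW.
rewrite [incl _ + w]addrC (vabsD_lt (y := incl _)) vabs_incl.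
  by rewrite ler_piMl ?vabs_ge0 // ltW.
exact: lt_le_trans wr rb.
Qed.

(** The value of the absolute polynomial |x - b| on B; [rhoE] shows that it depends only on the
    underlying set. *)
Definition rho (b : K) (B : disc Kc) : R :=
  Num.max (vabs (disc_center B - b)) (disc_radius B).

Lemma discP (B : disc Kc) :
  0 <= disc_radius B /\
  disc_set B = disc_of (disc_center B) (disc_radius B).
Proof. by rewrite /disc_radius /disc_center; case: cid. Qed.

Lemma rhoE (B : disc Kc) (a b : K) (r : R) : 0 <= r ->
  disc_set B = disc_of a r -> rho b B = Num.max (vabs (a - b)) r.
Proof.
move=> r0 Ba; rewrite /rho; have [r'0 Ba'] := discP B.
have [rr' aa'] : disc_radius B <= r /\ vabs (a - disc_center B) <= r.
  by apply: disc_of_subset => //; rewrite -Ba -Ba'.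
have [r'r _] : r <= disc_radius B /\ vabs (disc_center B - a) <= disc_radius B.
  by apply: disc_of_subset => //; rewrite -Ba -Ba'.
have -> : disc_radius B = r by apply/eqP; rewrite eq_le rr'.
by apply: max_vabs_center; rewrite vabsB.
Qed.

Lemma disc_radiusE (B : disc Kc) (a : K) (r : R) : 0 <= r ->
  disc_set B = disc_of a r -> disc_radius B = r.
Proof.
move=> r0 Ba; have [r'0 Ba'] := discP B.
have [rr' _] : disc_radius B <= r /\ vabs (a - disc_center B) <= r.
  by apply: disc_of_subset => //; rewrite -Ba -Ba'.
have [r'r _] : r <= disc_radius B /\ vabs (disc_center B - a) <= disc_radius B.
  by apply: disc_of_subset => //; rewrite -Ba -Ba'.
by apply/le_anti; rewrite rr'.
Qed.

Lemma dist_maxl (x y z : R) : `|Num.max x y - Num.max x z| <= `|y - z|.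
Proof.
have h1 := ler_norm (y - z); have h2 := ler_norm (z - y).
rewrite distrC in h2; have h0 := normr_ge0 (y - z).
rewrite ler_norml; case: (leP x y) => ?; case: (leP x z) => ?; apply/andP; lra.
Qed.

(** For nested discs both values can be written with the center of the smaller disc, so that only
    the radii differ, and a maximum is 1-Lipschitz in each argument. *)
Lemma rho_lipschitz (b : K) (B B' : disc Kc) :
  `|rho b B - rho b B'| <= disc_dist B B'.
Proof.
have nested (C C' : disc Kc) : disc_set C `<=` disc_set C' ->
    `|rho b C - rho b C'| <= nested_dist C C'.
  move=> CC'; have [r0 E] := discP C; have [r'0 E'] := discP C'.
  have [_ cc'] : disc_radius C <= disc_radius C' /\
      vabs (disc_center C' - disc_center C) <= disc_radius C'.
    by apply: disc_of_subset => //; rewrite -E -E'.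
  by rewrite /rho (max_vabs_center b cc') dist_maxl.
have nestedC (C C' : disc Kc) : disc_set C' `<=` disc_set C ->
    `|rho b C - rho b C'| <= nested_dist C C'.
  by move=> /nested; rewrite /nested_dist distrC [X in _ <= X]distrC.
rewrite /disc_dist; case: asboolP => [[/nested|/nestedC]//|_].
(* The join has radius d and can be centered at either disc's center, so each leg of the path
   through it changes only the radius. *)
set J := disc_join B B'; set d := vabs (disc_center B - disc_center B').
have d0 : 0 <= d := vabs_ge0 _.
have JE : rho b J = Num.max (vabs (disc_center B - b)) d by exact: rhoE.
have JE' : rho b J = Num.max (vabs (disc_center B' - b)) d.
  by rewrite JE; exact: max_vabs_center.
rewrite /nested_dist (disc_radiusE (B := J) d0 erefl).
apply: le_trans (ler_distD (rho b J) _ _) (lerD _ _).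
  by rewrite JE dist_maxl.
by rewrite JE' dist_maxl.
Qed.

End Density.

(** * Absolute values of products of linear polynomials *)

Section Polynomials.
Variables (R : realType) (K : valuedFieldType R).
Variables (Kc : completed_closure K) (n : nat).
Local Notation hatK := (cl_hat Kc).
Local Notation incl := (Defs.incl Kc).
Local Notation expo := {ffun 'I_n -> nat}.

(** Polynomials over K as lists of coefficients and exponents. Exponents may repeat, so addition is
    concatenation and no terms need collecting. *)
Definition eval_terms (s : seq (K * expo)) (z : 'I_n -> hatK) : hatK :=
  \sum_(t <- s) incl t.1 * \prod_(i < n) z i ^+ t.2 i.

Lemma eval_terms_linear_factors (L : seq ('I_n * K)) : exists s, forall z,
  eval_terms s z = \prod_(u <- L) (z u.1 - incl u.2).
Proof.
elim: L => [|[i b] L [s IH]].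
  exists [:: (1, [ffun=> 0%N])] => z.
  rewrite /eval_terms big_seq1 big_nil /Defs.incl !rmorph1 mul1r big1 // => j _.
  by rewrite ffunE.
(* Multiplication by x_i - b: one copy with the i-th exponent raised, one scaled by -b. *)
exists ([seq (t.1, [ffun j => (t.2 j + (j == i))%N]) | t : K * expo <- s] ++
        [seq (- b * t.1, t.2) | t <- s]) => z.
rewrite big_cons -IH /eval_terms big_cat !big_map /= mulrBl !mulr_sumr -sumrN.
congr (_ + _); apply: eq_bigr => t _.
  rewrite mulrCA; congr (_ * _); rewrite (bigD1 i) //= [in RHS](bigD1 i) //=.
  rewrite mulrA ffunE eqxx addn1 exprS; congr (_ * _).
  by apply: eq_bigr => j /negbTE ji; rewrite ffunE ji addn0.
by rewrite /Defs.incl mulNr !rmorphN !rmorphM mulNr mulrA.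
Qed.

Lemma disc_of_0 (a : K) (z : hatK) : disc_of a 0 z <-> z = incl a.
Proof.
rewrite /disc_of /= vabs_le0 subr_eq0; split; first by move=> /eqP.
by move=> ->.
Qed.

Lemma eval_terms_disc_poly (s : seq (K * expo)) : exists h : disc_poly Kc n,
  (exists c, forall alpha, disc_set (disc_coef h alpha) (c alpha)) /\
  forall c, (forall alpha, disc_set (disc_coef h alpha) (c alpha)) ->
  forall z, \sum_(alpha \in [set: expo]) c alpha * \prod_(i < n) z i ^+ alpha i
    = eval_terms s z.
Proof.
(* Like terms are collected into discs of radius 0, which leave a single choice of coefficients. *)
pose C alpha : K := \sum_(t <- s | t.2 == alpha) t.1.
pose S := undup [seq t.2 | t <- s].
have CS alpha : alpha \notin S -> C alpha = 0.
  rewrite mem_undup => /mapP aS; rewrite /C big_seq_cond big1 // => t.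
  by case/andP => ts /eqP ta; case: aS; exists t.
have C_fin : finite_set [set alpha |
    (mk_disc Kc (C alpha) (lexx 0) : set hatK) <> disc_of 0 0 :> set hatK].
  apply: (@sub_finite_set _ _ [set` S]); last exact: finite_seq.
  move=> alpha /= H; apply/negPn/negP => /CS C0; apply: H.
  by rewrite /mk_disc /= C0.
exists (DiscPoly C_fin); split.
  by exists (fun alpha => incl (C alpha)) => alpha; apply/disc_of_0.
move=> c cC z; have {cC} cE alpha : c alpha = incl (C alpha).
  by apply/disc_of_0; exact: cC.
rewrite (fsbigE S) ?undup_uniq //; last first.
  by move=> alpha _ /CS C0; rewrite cE C0 /Defs.incl !rmorph0 mul0r.
under eq_bigl do rewrite in_setT.
under eq_bigr do rewrite cE /Defs.incl !rmorph_sum mulr_suml.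
(* After the exchange each term t meets exactly one exponent of the duplicate-free list [S], namely
   [t.2]. *)
rewrite (exchange_big_dep predT) //= /eval_terms [RHS]big_seq [LHS]big_seq.
apply: eq_bigr => t ts.
rewrite -big_filter (_ : [seq _ <- S | _] = [:: t.2]) ?big_seq1 //.
rewrite -(filter_pred1_uniq (s := S)) ?undup_uniq //.
  by apply: eq_filter => alpha; rewrite /= eq_sym.
by rewrite mem_undup map_f.
Qed.

End Polynomials.

(** * Coordinate functions on polydiscs: multiplicativity, continuity, separation *)

Section PolydiscCoordinates.
Variables (R : realType) (K : valuedFieldType R).
Hypothesis K_nontrivial : nontrivial_valuation K.
Variables (Kc : completed_closure K) (n : nat).
Local Notation hatK := (cl_hat Kc).
Local Notation incl := (Defs.incl Kc).

Lemma polydisc_comp_spec (B : polydisc Kc n) :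
  polydisc_set B = [set z | forall i, disc_set (polydisc_comp B i) (z i)].
Proof.
rewrite /polydisc_comp; case: cid => -[a r] /= [r0 Br] /=.
by rewrite Br.
Qed.

(** The pair u = (i, b) encodes the linear polynomial x_i - b. *)
Definition coord_rho (u : 'I_n * K) (B : polydisc Kc n) : R :=
  rho u.2 (polydisc_comp B u.1).

Lemma coord_rho_ge0 u B : 0 <= coord_rho u B.
Proof. by rewrite /coord_rho /rho le_max vabs_ge0. Qed.

Lemma vabs_sub_le_rho (b : K) (B : disc Kc) (z : hatK) :
  disc_set B z -> vabs (z - incl b) <= rho b B.
Proof.
have [_ ->] := discP B; rewrite /disc_of /= => zB.
rewrite -(subrKA (incl (disc_center B))) /rho.
apply: vabsD_le_both; rewrite le_max.
  by rewrite (vabsB z) zB orbT.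
by rewrite -inclB vabs_incl lexx.
Qed.

Lemma polydisc_generic_point (B : polydisc Kc n) (t : R) (L : seq ('I_n * K)) :
  0 <= t -> t < 1 -> exists2 z, polydisc_set B z & forall u, u \in L ->
    t * coord_rho u B <= vabs (z u.1 - incl u.2).
Proof.
move=> t0 t1; have point i : exists z : hatK, disc_set (polydisc_comp B i) z /\
    forall u, u \in L -> u.1 = i -> t * coord_rho u B <= vabs (z - incl u.2).
  have [r0 BE] := discP (polydisc_comp B i).
  have [z zB zL] := @disc_generic_point _ _ K_nontrivial Kc
    (disc_center (polydisc_comp B i)) _ _ [seq u.2 | u <- L] r0 t0 t1.
  exists z; rewrite BE; split=> // u uL ui.
  by rewrite /coord_rho ui; apply: zL; exact: map_f.
have [z zP] := choice point.
exists z; first by rewrite polydisc_comp_spec => i; case: (zP i).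
by move=> u uL; have [_] := zP u.1; apply.
Qed.

(** The product bounds the supremum from above factor by factor. A generic point for t = 1 - e
    reaches (1 - e)^k M, with k the number of factors, and this is at least (1 - k e) M by
    Bernoulli; e is arbitrarily small. *)
Lemma abs_poly_linear_factors (L : seq ('I_n * K)) :
  exists h : disc_poly Kc n, forall B,
    abs_poly h B = \prod_(u <- L) coord_rho u B.
Proof.
have [s sE] := eval_terms_linear_factors Kc L.
have [h [[c cP] hE]] := eval_terms_disc_poly Kc s.
exists h => B; set M := \prod_(u <- L) coord_rho u B; rewrite /abs_poly.
set S := [set y | _].
have S_val z : polydisc_set B z ->
    S (\prod_(u <- L) vabs (z u.1 - incl u.2)).
  by move=> Bz; exists c, z; split => //; rewrite hE // sE vabs_prod.
have S_ub : ubound S M.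
  move=> _ [c' [z [c'P Bz ->]]]; rewrite hE // sE vabs_prod.
  apply: ler_prod => u _; rewrite vabs_ge0 /=; apply: vabs_sub_le_rho.
  by move: Bz; rewrite polydisc_comp_spec; apply.
have M0 : 0 <= M by apply: prodr_ge0 => u _; exact: coord_rho_ge0.
have S_lb e : 0 < e -> e <= 1 -> M - (size L)%:R * M * e <= sup S.
  move=> e0 e1; have [||z Bz zL] := @polydisc_generic_point B (1 - e) L.
  - by rewrite subr_ge0.
  - by rewrite gtrBl.
  have /(ub_le_sup (ex_intro _ M S_ub)) := S_val z Bz.
  apply: le_trans; apply: (@le_trans _ _ ((1 - e) ^+ size L * M)).
    have := @bernoulli_ineq _ (- e) (size L); rewrite lerN2 => /(_ e1) H.
    rewrite mulrAC -[X in X - _]mul1r -mulrBl; apply: ler_wpM2r => //.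
    by rewrite -mulrN.
  have -> : (1 - e) ^+ size L * M = \prod_(u <- L) ((1 - e) * coord_rho u B).
    by rewrite big_split /= big_const_seq count_predT iter_mulr_1.
  rewrite big_seq [leRHS]big_seq; apply: ler_prod => u uL.
  by rewrite zL // andbT mulr_ge0 ?coord_rho_ge0 ?subr_ge0.
apply/le_anti/andP; split.
  (* The generic point for t = 0 only witnesses that [S] is nonempty. *)
  apply: ge_sup => //; have [||z Bz _] := @polydisc_generic_point B 0 L => //.
  by exists (\prod_(u <- L) vabs (z u.1 - incl u.2)); exact: S_val.
rewrite leNgt; apply/negP => lt_M.
set N : R := (size L)%:R in S_lb *.
have NM : 0 <= N * M by rewrite mulr_ge0.
(* For e = d / (d + N M + 1) the loss N M e is less than the assumed gap d, a contradiction. *)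
pose d := M - sup S; have d0 : 0 < d by rewrite subr_gt0.
have dNM : 0 < d + N * M + 1 by lra.
have := S_lb (d / (d + N * M + 1)) (divr_gt0 d0 dNM).
rewrite ler_pdivrMr // mul1r => H.
have {H} : M - N * M * (d / (d + N * M + 1)) <= sup S by apply: H; lra.
rewrite lerBlDl -lerBlDr -/d mulrA ler_pdivlMr //.
rewrite [N * M * d]mulrC ler_pM2l //; lra.
Qed.

Lemma disc_dist_ge0 (B B' : disc Kc) : 0 <= disc_dist B B'.
Proof. by apply: le_trans (rho_lipschitz K_nontrivial 0 B B'). Qed.

Lemma disc_dist_le_polydisc_dist (p : \bar R) (B B' : polydisc Kc n) i :
  (1 <= p)%E ->
  disc_dist (polydisc_comp B i) (polydisc_comp B' i) <= polydisc_dist p B B'.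
Proof.
case: p => [q||] //=; last by move=> _; exact: (le_bigmax _ _ i).
rewrite lee_fin => q1; have q0 : q != 0 by rewrite gt_eqF // (lt_le_trans _ q1).
set d := fun j => disc_dist (polydisc_comp B j) (polydisc_comp B' j).
have d0 j : 0 <= d j := disc_dist_ge0 _ _.
rewrite -[leLHS]/(d i) -{1}[d i]powRr1 // -(divff q0) powRrM.
have q'0 : 0 <= q^-1 by rewrite invr_ge0 (le_trans _ q1).
apply: ge0_ler_powR => //; rewrite ?nnegrE ?powR_ge0 ?sumr_ge0 //.
- by move=> j _; exact: powR_ge0.
- by rewrite (bigD1 i) //= lerDl sumr_ge0 // => j _; exact: powR_ge0.
Qed.

Lemma coord_rho_continuous (p : \bar R) u : (1 <= p)%E ->
  continuous (coord_rho u : polydisc_space Kc p n -> R).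
Proof.
move=> p1; apply/continuousP => V Vo.
rewrite /open /= => B /= VB.
have /nbhs_ballP[e /= e0 eV] : nbhs (coord_rho u B) V.
  by apply: open_nbhs_nbhs.
exists e => // B' BB'; apply: eV; rewrite /ball /=.
apply: le_lt_trans BB'; apply: le_trans (disc_dist_le_polydisc_dist _ _ u.1 p1).
exact: rho_lipschitz.
Qed.

(** With b the center of a factor of C', the common value is the radius of that factor, so the
    corresponding factor of C lies within it; symmetry gives equality. *)
Lemma coord_rho_inj (B B' : polydisc Kc n) :
  (forall u, coord_rho u B = coord_rho u B') -> B = B'.
Proof.
move=> BB'; have half (C C' : polydisc Kc n) :
    (forall u, coord_rho u C = coord_rho u C') ->
    polydisc_set C `<=` polydisc_set C'.
  move=> CC'; rewrite !polydisc_comp_spec => z zC i.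
  have [r0 CE] := discP (polydisc_comp C i).
  have [r'0 CE'] := discP (polydisc_comp C' i).
  rewrite CE' /disc_of /= vabsB.
  apply: le_trans (vabs_sub_le_rho (disc_center (polydisc_comp C' i)) (zC i)) _.
  have := CC' (i, disc_center (polydisc_comp C' i)); rewrite /coord_rho /= => ->.
  by rewrite /rho subrr vabs0 max_r.
have : polydisc_set B = polydisc_set B'.
  by apply/seteqP; split; apply: half => // u; rewrite BB'.
case: B B' {BB' half} => [S SP] [S' SP'] /= SS'; case: _ / SS' in SP' *.
by congr Polydisc; exact: Prop_irrelevance.
Qed.

End PolydiscCoordinates.

(** * The algebra generated by the coordinate functions *)

Lemma continuous_sum_prod (R : realType) (T : topologicalType) (I : Type)
    (F : I -> T -> R) (s : seq (R * seq I)) : (forall i, continuous (F i)) ->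
  continuous (fun x => \sum_(t <- s) t.1 * \prod_(i <- t.2) F i x).
Proof.
move=> F_cont; have prod_cont (L : seq I) :
    continuous (fun x => \prod_(i <- L) F i x).
  elim: L => [|i L IH].
    rewrite (_ : (fun x => _) = cst 1); first exact: cst_continuous.
    by apply/funext => x; rewrite big_nil.
  rewrite (_ : (fun x => _) = fun x => F i x * \prod_(j <- L) F j x).
    by move=> x; apply: cvgM; [exact: F_cont|exact: IH].
  by apply/funext => x; rewrite big_cons.
elim: s => [|t s IH].
  rewrite (_ : (fun x => _) = cst 0); first exact: cst_continuous.
  by apply/funext => x; rewrite big_nil.
rewrite (_ : (fun x => _) = fun x => t.1 * (\prod_(i <- t.2) F i x) +
    \sum_(t <- s) t.1 * \prod_(i <- t.2) F i x).
  move=> x; apply: cvgD; last exact: IH.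
  by apply: cvgM; [exact: cvg_cst|exact: prod_cont].
by apply/funext => x; rewrite big_cons.
Qed.

Section LinearFactorAlgebra.
Variables (R : realType) (K : valuedFieldType R).
Variables (Kc : completed_closure K) (n : nat).
Local Notation term := (R * seq ('I_n * K))%type.

(** In list form a sum is a concatenation, a product runs over all pairs, and an empty list of
    factors gives a constant. *)
Definition rho_sum (s : seq term) (B : polydisc Kc n) : R :=
  \sum_(t <- s) t.1 * \prod_(u <- t.2) coord_rho u B.

Lemma rho_sum1 (c : R) (L : seq ('I_n * K)) B :
  rho_sum [:: (c, L)] B = c * \prod_(u <- L) coord_rho u B.
Proof. exact: big_seq1. Qed.

Lemma rho_sumD (s s' : seq term) B :
  rho_sum (s ++ s') B = rho_sum s B + rho_sum s' B.
Proof. exact: big_cat. Qed.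

Lemma rho_sumM (s s' : seq term) B :
  rho_sum [seq (t.1 * t'.1, t.2 ++ t'.2) | t <- s, t' <- s'] B =
  rho_sum s B * rho_sum s' B.
Proof.
rewrite /rho_sum big_allpairs_dep mulr_suml; apply: eq_bigr => t _.
by rewrite mulr_sumr; apply: eq_bigr => t' _; rewrite big_cat mulrACA.
Qed.

Hypothesis K_nontrivial : nontrivial_valuation K.

Lemma rho_sum_continuous (p : \bar R) (s : seq term) : (1 <= p)%E ->
  continuous (rho_sum s : polydisc_space Kc p n -> R).
Proof.
move=> p1; apply: (@continuous_sum_prod _ (polydisc_space Kc p n)) => u.
exact: coord_rho_continuous.
Qed.

(** Each product of coordinate functions is a single absolute polynomial, so the whole algebra
    consists of linear combinations. *)
Lemma rho_sum_lin_comb (s : seq term) : lin_comb_abs_poly (rho_sum s).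
Proof.
have [h hE] := choice (@abs_poly_linear_factors _ _ K_nontrivial Kc n).
pose t0 : term := (0, [::]).
exists (size s), (fun j => (nth t0 s j).1), (fun j => h (nth t0 s j).2) => B.
rewrite /rho_sum (big_nth t0) big_mkord.
by apply: eq_bigr => j _; rewrite hE.
Qed.

End LinearFactorAlgebra.

Theorem theorem45 (R : realType) (K : valuedFieldType R)
  (K_nontrivial : nontrivial_valuation K) (K_complete : complete_valued K)
  (Kc : completed_closure K) (n : nat) (p : \bar R) (p_ge1 : (1 <= p)%E)
  (D : set (polydisc_space Kc p n)) (D_compact : compact D)
  (f : polydisc_space Kc p n -> R) (f_cont : {within D, continuous f})
  (eps : R) (eps_gt0 : 0 < eps) :
  exists g : polydisc Kc n -> R,
    lin_comb_abs_poly g /\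
    (sup_norm D (fun B => (f B - g B)%R) <= eps%:E)%E.
Proof.
pose A : set (polydisc_space Kc p n -> R) :=
  [set g | exists s, g = rho_sum s].
have [|||||g [s ->] fg] := stone_weierstrass (A := A) D_compact _ _ _ _ _ f_cont eps_gt0.
- by move=> c; exists [:: (c, [::])]; apply/funext => B; rewrite rho_sum1 big_nil mulr1.
- by move=> _ _ [s ->] [s' ->]; exists (s ++ s'); apply/funext => B; rewrite rho_sumD.
- move=> _ _ [s ->] [s' ->].
  exists [seq (t.1 * t'.1, t.2 ++ t'.2) | t <- s, t' <- s'].
  by apply/funext => B; rewrite rho_sumM.
- move=> _ [s ->]; apply: continuous_subspaceT.
  exact: rho_sum_continuous.
(* If no function of the algebra separated B from B', all coordinate functions would agree on them,
   forcing B = B'. *)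
- move=> B B' _ _ BB'; apply: contrapT => H; apply: BB'.
  apply: coord_rho_inj => // u; apply: contrapT => uBB'; apply: H.
  exists (rho_sum [:: (1, [:: u])]); first by exists [:: (1, [:: u])].
  by rewrite !rho_sum1 !big_seq1 !mul1r.
- exists (rho_sum s); split; first exact: rho_sum_lin_comb.
  by apply: ge_ereal_sup => _ [B DB <-]; rewrite lee_fin fg.
Qed.
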